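(* Let $d\ge 1$, let $n=(n_1,\dots,n_d)$, and let $p\in\mathbb{C}[z_1,\dots,z_d]$ have multidegree at most $n$, no zeros in $\mathbb{D}^d$, and no nonconstant common factor with its reflection $\tilde p$ (at multidegree $n$); assume $\tilde p(0)=0$ and let $f=\frac{p+\tilde p}{p-\tilde p}$. Let $v\in\mathbb{C}[z_1,\dots,z_d]$ be a polynomial of multidegree at most $n$ with $v=\tilde v$, $v(0)=0$, such that $p+v$ and $p-av$ have no zeros in $\mathbb{D}^d$ for some $a>0$, and such that $$\frac{p+\tilde p+2v}{p-\tilde p}$$ is an element of the face $\mathcal{F}(f)$ of $f$ in $PRP_d$. If $p$ vanishes at $\zeta\in\mathbb{T}^d$ to order $M$, then $v$ vanishes at least to order $M$ at $\zeta$.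
   Context: $\mathbb{D}$ is the open unit disk, $\mathbb{T}$ the unit circle. $PRP_d$ is the convex set of holomorphic functions $f:\mathbb{D}^d\to\{w\in\mathbb{C}:\operatorname{Re}w>0\}$ with $f(0)=1$. For an element $x$ of a convex set $S$, the face $\mathcal{F}(x)$ is the union of all line segments $L\subset S$ having $x$ in the interior of $L$, with $\mathcal{F}(x)=\{x\}$ if $x$ is an extreme point. For a polynomial $q$ of multidegree at most $n$ (degree in $z_j$ at most $n_j$), its reflection at multidegree $n$ is $\tilde q(z)=z_1^{n_1}\cdots z_d^{n_d}\,\overline{q(1/\bar z_1,\dots,1/\bar z_d)}$; all reflections here are at the same $n$. (Every element of $\mathcal{F}(f)$ can be written in the form $\frac{p+\tilde p+2v}{p-\tilde p}$ with $v$ having the listed properties; this is a known theorem of McDonald.) A polynomial $q$ vanishes to order $M$ at $\zeta$ if the lowest-degree nonzero homogeneous term of the expansion of $q$ around $\zeta$ has total degree $M$; it vanishes at least to order $M$ if all homogeneous terms of degree less than $M$ are zero. *)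

(* Defs.v *)
From HB Require Import structures.
From mathcomp Require Import all_boot all_order all_algebra.
From mathcomp Require Import complex.
From mathcomp Require Import all_classical all_reals all_analysis.
(* The notations of mpoly and of mathcomp-analysis are incompatible, hence the
   prefix forms meval, mcoeff, mpolyX, ... below. *)
From mathcomp Require mpoly.
Import -(notations) mpoly.

Set Implicit Arguments.
Unset Strict Implicit.
Unset Printing Implicit Defensive.

Import Order.TTheory GRing.Theory Num.Theory.
Import numFieldNormedType.Exports.

Local Open Scope classical_set_scope.
Local Open Scope complex_scope.
Local Open Scope ring_scope.

(* These are applied with K := R[i] (R : realType).  There [x <= y] means that
   [y - x] is a nonnegative real, so [0 <= t <= 1] forces [t] to be real and
   [segment] is the usual real line segment. *)
Section Faces.
Variables (K : numDomainType) (V : lmodType K).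
Implicit Types (S : set V) (a b x : V).

Definition segment a b : set V :=
  [set y | exists2 t : K, 0 <= t <= 1 & y = (1 - t) *: a + t *: b].

Definition open_segment a b : set V :=
  [set y | exists2 t : K, 0 < t < 1 & y = (1 - t) *: a + t *: b].

Definition extreme_point S x : Prop :=
  S x /\ forall a b, S a -> S b -> open_segment a b x -> a = b.

Definition face S x : set V :=
  [set y | (exists a b, [/\ a <> b, segment a b `<=` S,
                            open_segment a b x & segment a b y])
           \/ (extreme_point S x /\ y = x)].

End Faces.

Definition polydisk (K : numDomainType) (d : nat) : set 'rV[K]_d :=
  [set z | forall i, `|z 0 i| < 1].
Arguments polydisk : clear implicits.

Definition polytorus (K : numDomainType) (d : nat) : set 'rV[K]_d :=
  [set z | forall i, `|z 0 i| = 1].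
Arguments polytorus : clear implicits.

(* [differentiable] is Frechet differentiability over the field K, that is,
   complex differentiability when K = R[i]. *)
Definition holomorphic_on (K : numFieldType) (d : nat)
    (D : set 'rV[K]_d) (f : 'rV[K]_d -> K) : Prop :=
  forall z, D z -> differentiable f z.

(* A function on the polydisk is represented by the total function that
   extends it by 0, so that Leibniz equality of representatives is equality
   on the polydisk. *)
Definition on_polydisk (K : numFieldType) (d : nat) (f : 'rV[K]_d -> K) :
    'rV[K]_d -> K :=
  patch (fun=> 0) (polydisk K d) f.

Definition PRP (R : realType) (d : nat) : set ('rV[R[i]]_d -> R[i]) :=
  [set f | [/\ f = on_polydisk f,
               holomorphic_on (polydisk R[i] d) f,
               forall z, polydisk R[i] d z -> 0 < complex.Re (f z)
             & f 0 = 1]].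
Arguments PRP : clear implicits.

Definition ratfun (K : numFieldType) (d : nat) (p q : mpoly d K) :
    'rV[K]_d -> K :=
  on_polydisk (fun z => meval (z 0) p / meval (z 0) q).

Definition multidegree_le (K : nzRingType) (d : nat) (n : multinom d)
    (q : mpoly d K) : Prop :=
  forall m, m \in msupp q -> forall j, (m j <= n j)%N.

Definition zero_free (K : numFieldType) (d : nat) (q : mpoly d K) : Prop :=
  forall z, polydisk K d z -> meval (z 0) q != 0.

Definition no_common_factor (K : nzRingType) (d : nat) (p q : mpoly d K) :
    Prop :=
  forall g u w : mpoly d K, p = g * u -> q = g * w ->
    exists c : K, g = mpolyC d c.

(* The reflection as a polynomial; [reflectionE] is its defining formula.
   It is meaningful only when [multidegree_le n q], since [mnm_sub] truncates. *)
Definition reflection (K : numClosedFieldType) (d : nat) (n : multinom d)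
    (q : mpoly d K) : mpoly d K :=
  \sum_(m <- msupp q) (mcoeff m q)^* *: mpolyX K (mnm_sub n m).

Lemma reflectionE (K : numClosedFieldType) (d : nat) (n : multinom d)
    (q : mpoly d K) (z : 'rV[K]_d) :
  multidegree_le n q -> (forall j, z 0 j != 0) ->
  meval (z 0) (reflection n q) =
    (\prod_j z 0 j ^+ n j) * (meval (fun j => ((z 0 j)^*)^-1) q)^*.
Proof.
move=> qn z0; rewrite [meval _ q]mevalE raddf_sum rmorph_sum /= mulr_sumr.
rewrite big_seq [RHS]big_seq; apply: eq_bigr => m /qn mn.
rewrite mevalZ mevalX rmorphM /= mulrCA rmorph_prod -big_split /=.
congr (_ * _); apply: eq_bigr => j _.
by rewrite rmorphXn fmorphV /= conjCK mnmBE expfB_cond ?(negbTE (z0 j)) ?mn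
  ?exprVn.
Qed.

(* The polynomial w |-> q (zeta + w). *)
Definition translate (K : comNzRingType) (d : nat) (zeta : 'rV[K]_d)
    (q : mpoly d K) : mpoly d K :=
  comp_mpoly [tuple mpolyX K (mnm1 i) + mpolyC d (zeta 0 i) | i < d] q.

Lemma translateE (K : comNzRingType) (d : nat) (zeta w : 'rV[K]_d)
    (q : mpoly d K) :
  meval (w 0) (translate zeta q) = meval ((zeta + w) 0) q.
Proof.
rewrite /translate comp_mpoly_meval; apply: meval_eq => i.
by rewrite !tnth_mktuple mevalD mevalXU mevalC mxE addrC.
Qed.

Definition homogeneous_term (K : comNzRingType) (d : nat) (zeta : 'rV[K]_d)
    (k : nat) (q : mpoly d K) : mpoly d K :=
  pihomog mdeg k (translate zeta q).

Definition vanishes_at_least_to_order (K : comNzRingType) (d : nat)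
    (zeta : 'rV[K]_d) (M : nat) (q : mpoly d K) : Prop :=
  forall k, (k < M)%N -> homogeneous_term zeta k q = 0.

Definition vanishes_to_order (K : comNzRingType) (d : nat)
    (zeta : 'rV[K]_d) (M : nat) (q : mpoly d K) : Prop :=
  vanishes_at_least_to_order zeta M q /\ homogeneous_term zeta M q <> 0.

(* Main.v *)
(** Write u = 2v / (p - p~).  Membership in the face makes both f + u and
    f - eps u have positive real part on the polydisk for some eps > 0.
    Restrict to the complex line z_j = zeta_j (1 - s w_j), w_j > 0, which enters
    the polydisk for small s with Re s > 0.  In s, both p and p~ are divisible
    by s^M.  If v had order N < M at zeta then, for a suitable w, u would have a
    pole at s = 0 of order k >= 1 with some leading coefficient g, dominating f,
    so that Re (g s^-k) would be both nonnegative and nonpositive on Re s > 0;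
    this forces g = 0. *)
Require Import Defs.
From HB Require Import structures.
From mathcomp Require Import all_boot all_order all_algebra.
From mathcomp Require Import complex.
From mathcomp Require Import all_classical all_reals all_analysis.
From mathcomp Require Import ring.
From mathcomp Require mpoly.
Import -(notations) mpoly.
Import Order.TTheory GRing.Theory Num.Theory.
Import numFieldNormedType.Exports.

Local Open Scope classical_set_scope.
Local Open Scope complex_scope.
Local Open Scope ring_scope.

Set Implicit Arguments.
Unset Strict Implicit.
Unset Printing Implicit Defensive.

(** * Polynomials vanishing on an infinite grid *)

Definition mnm_init (d : nat) (m : multinom d.+1) : multinom d :=
  Multinom [tuple m (widen_ord (leqnSn d) i) | i < d].

Lemma mnm_init_eq (d : nat) (m m' : multinom d.+1) :
  (mnm_init m' == mnm_init m) && (m' ord_max == m ord_max) = (m' == m).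
Proof.
apply/andP/eqP => [[/eqP/mnmP mm' /eqP max]|-> //].
apply/mnmP => i; case: (unliftP ord_max i) => [j ->|-> //].
have := mm' j; rewrite !mnmE.
by have -> : widen_ord (leqnSn d) j = lift ord_max j
  by apply/val_inj; rewrite /= /bump leqNgt ltn_ord.
Qed.

Lemma mcoeff_muni (K : nzRingType) (d : nat) (q : mpoly d.+1 K)
    (m : multinom d.+1) :
  mcoeff (mnm_init m) (muni q)`_(m ord_max) = mcoeff m q.
Proof.
rewrite muniE coef_sum raddf_sum /= [in RHS](mpolyE q) raddf_sum /=.
apply: eq_bigr => m' _.
rewrite coefZ coefXn eq_sym mulr_natr mcoeffMn !mcoeffZ !mcoeffX.
rewrite -mulrnAr -mulrnA mulnb -mnm_init_eq [X in _ && X]eq_sym.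
by [].
Qed.


Lemma meval_muni (K : comNzRingType) (d : nat) (q : mpoly d.+1 K)
    (x : 'I_d.+1 -> K) :
  meval x q
  = (map_poly (meval (fun i => x (widen_ord (leqnSn d) i))) (muni q)).[x ord_max].
Proof.
rewrite muniE raddf_sum /= horner_sum mevalE; apply: eq_bigr => m _.
rewrite map_polyZ map_polyXn hornerZ hornerXn [X in _ = X * _]mevalZ mevalX -mulrA.
rewrite big_ord_recr /=; congr (_ * (_ * _)).
by apply: eq_bigr => i _; rewrite mnmE.
Qed.

Lemma poly_infinite_roots (K : idomainType) (P : {poly K}) (S : nat -> K) :
  injective S -> (forall k, P.[S k] = 0) -> P = 0.
Proof.
move=> S_inj PS; apply: (@roots_geq_poly_eq0 _ _ (map S (iota 0 (size P)))).
- by apply/allP => _ /mapP[k _ ->]; apply/rootP.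
- by rewrite map_inj_uniq // iota_uniq.
- by rewrite size_map size_iota.
Qed.

(** Induction on [d]: once the other coordinates are fixed on the grid, the polynomial in the last
    variable has infinitely many roots, so each of its coefficients vanishes on the smaller grid. *)
Lemma mpoly_eq0_infinite_grid (K : idomainType) (d : nat) (S : 'I_d -> nat -> K)
    (q : mpoly d K) :
  (forall i, injective (S i)) ->
  (forall w : 'I_d -> nat, meval (fun i => S i (w i)) q = 0) -> q = 0.
Proof.
elim: d S q => [|d IHd] S q S_inj q0.
  have m0 (m : multinom 0) : m = mnm0 by apply/mnmP; case.
  have := q0 (fun=> 0%N); rewrite mevalE => q00; apply/mpolyP => m.
  rewrite mcoeff0 -q00 [in LHS](mpolyE q) raddf_sum /=.
  apply: eq_bigr => m' _; rewrite big_ord0 mcoeffZ mcoeffX.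
  by rewrite (m0 m) (m0 m') eqxx.
suff muni0 k : (muni q)`_k = 0.
  by apply/mpolyP => m; rewrite -mcoeff_muni muni0 !mcoeff0.
apply: (IHd (fun i => S (widen_ord (leqnSn d) i))) => [i|w]; first exact: S_inj.
set x := fun i => _.
rewrite -[LHS](coef_map (meval x)) /=.
suff -> : map_poly (meval x) (muni q) = 0 by rewrite coef0.
apply: (poly_infinite_roots (S_inj ord_max)) => k'.
pose w' (i : 'I_d.+1) := if unlift ord_max i is Some j then w j else k'.
rewrite -[RHS](q0 w') meval_muni.
have -> : w' ord_max = k' by rewrite /w' unlift_none.
congr (map_poly (meval _) _).[_]; apply/funext => i; rewrite /x.
have -> : widen_ord (leqnSn d) i = lift ord_max i
  by apply/val_inj; rewrite /= /bump leqNgt ltn_ord.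
by rewrite /w' liftK.
Qed.

(** * One-variable polynomials on a real ray at 0 *)

Lemma poly_lipschitz0 (K : numDomainType) (P : {poly K}) :
  exists2 B : K, 0 < B & forall r : K, 0 <= r <= 1 -> `|P.[r] - P.[0]| <= B * r.
Proof.
have /factor_theorem[Q PQ] : root (P - P.[0]%:P) 0.
  by rewrite /root !hornerE subrr.
have [B QB] := poly_disk_bound Q 1.
have B_ge0 : 0 <= B by apply: le_trans (QB 0 _); rewrite ?normr0 ?ler01.
exists (B + 1); first exact: ltr_wpDl.
move=> r /andP[r0 r1].
have -> : P.[r] - P.[0] = Q.[r] * r.
  transitivity (P - (P.[0])%:P).[r]; first by rewrite !hornerE.
  by rewrite PQ hornerM hornerXsubC subr0.
rewrite normrM (ger0_norm r0); apply: ler_wpM2r => //.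
apply: le_trans (QB r _) _; first by rewrite ger0_norm.
by rewrite lerDl ler01.
Qed.

(** Plays the role of the limit r -> 0, by order alone. *)
Lemma real_le0_small_multiples (K : numFieldType) (x B delta : K) :
  0 < delta -> 0 < B -> x \is Num.real ->
  (forall r, 0 < r < delta -> x <= B * r) -> x <= 0.
Proof.
move=> d0 B0 xR xB; rewrite real_leNgt ?real0 //; apply/negP => x0.
have den0 : 0 < x + B * delta by rewrite addr_gt0 ?mulr_gt0.
(* This r is below [delta] and satisfies B r < x. *)
have /xB : 0 < delta * (x / (x + B * delta)) < delta.
  rewrite mulr_gt0 ?divr_gt0 //= gtr_pMr // ltr_pdivrMr // mul1r.
  by rewrite ltrDl mulr_gt0.
rewrite mulrA [X in _ <= X]mulrCA ler_pMr // ler_pdivlMr // mul1r.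
by rewrite gerDr lt_geF.
Qed.

Lemma horner0_eq0_bigO (K : numFieldType) (P : {poly K}) (B delta : K) :
  0 < delta <= 1 -> 0 < B ->
  (forall r, 0 < r < delta -> `|P.[r]| <= B * r) -> P.[0] = 0.
Proof.
move=> /andP[d0 d1] B0 PB; have [B' B'0 PB'] := poly_lipschitz0 P.
apply/eqP; rewrite -normr_le0.
apply: (@real_le0_small_multiples _ _ (B + B') delta) => //.
- exact: addr_gt0.
move=> r /andP[r0 rd].
rewrite mulrDl -(subrK P.[r] P.[0]) addrC.
apply: le_trans (ler_normD _ _) _; apply: lerD.
  by apply: PB; rewrite r0.
by rewrite distrC; apply: PB'; rewrite ltW //= ltW // (lt_le_trans rd).
Qed.

(** Each power of r in the bound forces a root at 0, and dividing by 'X uses up that power. This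
    turns size estimates into divisibility, for [p] and its reflection alike. *)
Lemma bigO_polyXn_dvd (K : numFieldType) (M : nat) (P : {poly K}) (B delta : K) :
  0 < delta <= 1 -> 0 < B ->
  (forall r, 0 < r < delta -> `|P.[r]| <= B * r ^+ M) ->
  exists Q, P = Q * 'X^M.
Proof.
move=> dP B0; elim: M P => [|M IHM] P PB; first by exists P; rewrite mulr1.
have [d0 d1] := andP dP.
have P0 : P.[0] = 0.
  apply: (horner0_eq0_bigO dP B0) => r rd.
  have [r0 r1] := andP rd; apply: le_trans (PB r rd) _.
  rewrite ler_wpM2l ?(ltW B0) // exprS ger_pMr // exprn_ile1 // ?(ltW r0) //.
  by rewrite ltW // (lt_le_trans r1).
have /factor_theorem[Q PQ] : root P 0 by apply/rootP.
have [r rd|Q' QQ'] := IHM Q; last first.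
  by exists Q'; rewrite PQ QQ' subr0 exprSr mulrA.
have := PB r rd; rewrite PQ !hornerE subr0 normrM exprSr mulrA.
by case/andP: rd => r0 _; rewrite (gtr0_norm r0) ler_pM2r.
Qed.

Lemma Re_horner0_ge0 (K : numClosedFieldType) (P : {poly K}) (delta : K) :
  0 < delta <= 1 -> (forall r, 0 < r < delta -> 0 < 'Re P.[r]) -> 0 <= 'Re P.[0].
Proof.
move=> /andP[d0 d1] P_gt0; have [B B0 PB] := poly_lipschitz0 P.
rewrite -oppr_le0; apply: (real_le0_small_multiples d0 B0).
  by rewrite realN Creal_Re.
move=> r /andP[r0 rd]; apply: le_trans (PB r _); last first.
  by rewrite ltW //= ltW // (lt_le_trans rd).
apply: le_trans (leif_Re_Creal _); rewrite raddfB /= lerDr ltW //.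
by apply: P_gt0; rewrite r0.
Qed.

Lemma ray_leading_ge0 (K : numClosedFieldType) (A D : {poly K}) (N L : nat)
    (c delta : K) :
  0 < delta <= 1 ->
  (forall r, 0 < r < delta ->
     0 < 'Re ((A * 'X^N).[r * c] * ((D * 'X^L).[r * c])^*)) ->
  0 <= 'Re (A.[0] * c ^+ N * (D.[0] * c ^+ L)^*).
Proof.
move=> dP AD.
(* Conjugating coefficients makes the conjugated factor a polynomial in r, correct at real r. The
   positive factor r^(N+L) has been taken out. *)
pose P := (A \Po (c *: 'X)) * map_poly Num.conj (D \Po (c *: 'X))
            * (c ^+ N * (c ^+ L)^*)%:P.
have PE r : r^* = r -> P.[r] = A.[r * c] * (D.[r * c])^* * (c ^+ N * (c ^+ L)^*).
  move=> rR; rewrite /P !hornerM hornerC; congr (_ * _ * _).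
    by rewrite horner_comp !hornerE mulrC.
  by rewrite -[r in LHS]rR horner_map /= horner_comp !hornerE mulrC.
have -> : A.[0] * c ^+ N * (D.[0] * c ^+ L)^* = P.[0].
  by rewrite PE ?rmorph0 // mul0r rmorphM /= mulrACA.
apply: Re_horner0_ge0 dP _ => r rd; have [r0 _] := andP rd.
have rR : r^* = r by apply/CrealP/gtr0_real.
have rNL : 0 < r ^+ (N + L) by apply: exprn_gt0.
have := AD r rd; set z := (X in 'Re X).
have -> : z = r ^+ (N + L) * P.[r].
  rewrite PE // /z !hornerM !hornerXn !exprMn !rmorphM !rmorphXn /= rR exprD.
  by ring.
by rewrite ReMl ?gtr0_real // pmulr_rgt0.
Qed.

(* On c = 1 + i t the hypothesis is a polynomial identity in the real variable t,
   hence an identity of polynomials; at t = i only the term of g survives. *)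
Lemma half_plane_re_eq0 (K : numClosedFieldType) (g : K) (N L : nat) :
  (N < L)%N ->
  (forall c, 0 < 'Re c -> 'Re (g * (c ^+ N * (c ^+ L)^*)) = 0) ->
  g = 0.
Proof.
move=> NL g_re; pose k := (L - N)%N.
have k0 : (0 < k)%N by rewrite subn_gt0.
pose P : {poly K} := g *: (1 - 'i *: 'X) ^+ k + g^* *: (1 + 'i *: 'X) ^+ k.
have P0 : P = 0.
  apply: (@poly_infinite_roots K P (fun t => t%:R)) => [s t|t].
    by move/eqP; rewrite eqr_nat => /eqP.
  set c : K := 1 + 'i * t%:R.
  have tR : t%:R \is @Num.real K by apply: realn.
  have cJ : c^* = 1 - 'i * t%:R by rewrite conjC_rect ?real1.
  have Rec : 0 < 'Re c by rewrite Re_rect ?real1.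
  have cc0 : c * c^* != 0.
    rewrite -normCK expf_neq0 // normr_eq0; apply: contraTneq Rec => ->.
    by rewrite raddf0 ltxx.
  have := g_re c Rec.
  have -> : c ^+ N * (c ^+ L)^* = (c * c^*) ^+ N * c^* ^+ k.
    by rewrite rmorphXn /= -(subnKC (ltnW NL)) exprD mulrA exprMn.
  rewrite mulrCA ReMl; last by rewrite -normCK rpredX // rpredX // normr_real.
  move/eqP; rewrite mulf_eq0 expf_eq0 (negPf cc0) andbF /= ReE.
  rewrite mulf_eq0 invr_eq0 pnatr_eq0 orbF => /eqP <-.
  by rewrite rmorphM rmorphXn /= conjCK cJ /P !hornerE.
have := congr1 (horner^~ 'i) P0.
rewrite !hornerE -expr2 sqrCi subrr expr0n eqn0Ngt k0 /= mulr0 addr0 opprK -mulr2n.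
by move/eqP; rewrite mulf_eq0 expf_eq0 pnatr_eq0 andbF orbF => /eqP.
Qed.

(** * Homogeneous terms and restriction to a line *)

Lemma mcoeff_pihomog (K : nzRingType) (d k : nat) (q : mpoly d K)
    (m : multinom d) :
  mcoeff m (pihomog mdeg k q) = if mdeg m == k then mcoeff m q else 0.
Proof.
rewrite pihomogE {3}(mpolyE q) !raddf_sum /=.
rewrite big_mkcond /=; case: eqP => mk; [apply: eq_bigr|apply: big1] => m' _.
  case: eqP => // m'k; rewrite mcoeffZ mcoeffX; case: eqP => [mm'|]; last by rewrite mulr0.
  by case: m'k; rewrite mm'.
case: eqP => // m'k; rewrite mcoeffZ mcoeffX; case: eqP => [mm'|]; last by rewrite mulr0.
by case: mk; rewrite -mm'.
Qed.

Lemma meval_pihomog_scale (K : comNzRingType) (d k : nat) (q : mpoly d K)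
    (y : 'rV[K]_d) (s : K) :
  meval ((s *: y) 0) (pihomog mdeg k q) = s ^+ k * meval (y 0) (pihomog mdeg k q).
Proof.
rewrite pihomogE !raddf_sum mulr_sumr /=; apply: eq_bigr => m /eqP mk.
rewrite !mevalZ !mevalX mulrCA; congr (_ * _).
under eq_bigr do rewrite mxE exprMn.
by rewrite big_split /= prodrXr -mdegE mk.
Qed.

Section Line.
Variables (K : comNzRingType) (d : nat) (zeta y : 'rV[K]_d).
Implicit Type q : mpoly d K.

(** The restriction of q to the line s -> zeta + s y, built from the homogeneous terms at [zeta] so
    that vanishing there is read off the coefficients. *)
Definition line_poly q : {poly K} :=
  \poly_(k < mmeasure mdeg (translate zeta q)) meval (y 0) (homogeneous_term zeta k q).

Lemma coef_line_poly q k :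
  (line_poly q)`_k = meval (y 0) (homogeneous_term zeta k q).
Proof.
rewrite coef_poly; case: ltnP => // qk.
suff -> : homogeneous_term zeta k q = 0 by rewrite meval0.
apply/mpolyP => m; rewrite mcoeff_pihomog mcoeff0; case: eqP => // mk.
by apply/eqP; rewrite mcoeff_eq0 msize_mdeg_ge // mk.
Qed.

Lemma horner_line_poly q (s : K) :
  (line_poly q).[s] = meval ((zeta + s *: y) 0) q.
Proof.
rewrite -translateE.
rewrite [in RHS](@pihomog_partitionE _ _ mdeg _ (translate zeta q) (leqnn _)).
rewrite horner_poly raddf_sum /=; apply: eq_bigr => k _.
by rewrite meval_pihomog_scale mulrC.
Qed.

End Line.

(** Only monomials of degree at least M survive in the translate, and each is at most rho^M since
    rho <= 1. The constant is the sum of the coefficient moduli, plus 1 for strict positivity. *)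
Lemma vanishing_bound (K : numFieldType) (d M : nat) (zeta : 'rV[K]_d)
    (q : mpoly d K) :
  vanishes_at_least_to_order zeta M q ->
  exists2 B : K, 0 < B & forall (x : 'rV[K]_d) (rho : K),
    0 <= rho <= 1 -> (forall i, `|x 0 i| <= rho) ->
    `|meval ((zeta + x) 0) q| <= B * rho ^+ M.
Proof.
move=> qM; pose t := translate zeta q.
exists (\sum_(m <- msupp t) `|mcoeff m t| + 1).
  by apply: ltr_wpDl => //; apply: sumr_ge0.
move=> x rho /andP[rho0 rho1] xrho.
have rhoM : 0 <= rho ^+ M by apply: exprn_ge0.
rewrite -translateE -/t mevalE; apply: le_trans (ler_norm_sum _ _ _) _.
rewrite mulrDl mul1r ler_wpDr // mulr_suml big_seq [X in _ <= X]big_seq.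
apply: ler_sum => m mt; rewrite normrM ler_wpM2l // normr_prod.
have Mm : (M <= mdeg m)%N.
  rewrite leqNgt; apply/negP => /qM/(congr1 (mcoeff m)).
  by rewrite mcoeff_pihomog eqxx mcoeff0 => /eqP; rewrite mcoeff_eq0 mt.
apply: (@le_trans _ _ (\prod_i rho ^+ m i)).
  by apply: ler_prod => i _; rewrite normr_ge0 normrX lerXn2r // nnegrE.
by rewrite prodrXr -mdegE ler_wiXn2l.
Qed.

(** * Lines entering the polydisk at a torus point *)

(** Positive integer weights make every coordinate point into the disk, while the directions still
    form an infinite grid. *)
Definition inward (K : numDomainType) (d : nat) (zeta : 'rV[K]_d)
    (w : 'I_d -> nat) : 'rV[K]_d :=
  \row_i (- zeta 0 i * (w i).+1%:R).

Section Inward.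
Variables (K : numClosedFieldType) (d : nat) (zeta : 'rV[K]_d).
Variable w : 'I_d -> nat.
Hypothesis zetaT : polytorus K d zeta.

(** Exceeds every weight; the outer successor keeps it positive even for an empty sum. *)
Let W := (\sum_i (w i).+1).+1.
Local Notation y := (inward zeta w).

Let w_le i : (w i).+1%:R <= W%:R :> K.
Proof. by rewrite ler_nat ltnW // /W ltnS (bigD1 i) //= leq_addr. Qed.

Let inwardE (s : K) i : (zeta + s *: y) 0 i = zeta 0 i * (1 - s * (w i).+1%:R).
Proof. by rewrite !mxE; ring. Qed.

Lemma inward_polydisk (c : K) : 0 < 'Re c ->
  exists2 delta : K, 0 < delta <= 1 &
    forall r, 0 < r < delta -> polydisk K d (zeta + (r * c) *: y).
Proof.
move=> c0; set e := 'Re c + W%:R * `|c| ^+ 2.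
have e0 : 0 < e by rewrite ltr_wpDr // mulr_ge0 // exprn_ge0.
(* Chosen so that r W |c|^2 < Re c, which beats the quadratic term of |1 - r c t|^2 for each weight
   t <= W; the summand Re c in [e] gives delta <= 1. *)
exists ('Re c / e).
  by rewrite divr_gt0 //= ler_pdivrMr // mul1r lerDl mulr_ge0 // exprn_ge0.
move=> r /andP[r0]; rewrite ltr_pdivlMr // => re i.
have rR : r \is Num.real by apply: gtr0_real.
rewrite inwardE normrM zetaT mul1r -(@expr_lt1 _ 2) //.
set t : K := (w i).+1%:R; have t0 : 0 < t by rewrite ltr0n.
have tR : t \is Num.real by apply: gtr0_real.
have -> : `|1 - r * c * t| ^+ 2 = 1 - (r * t) * (2 * 'Re c - r * t * `|c| ^+ 2).
  rewrite !normCK rmorphB rmorph1 !rmorphM /= (conj_Creal rR) (conj_Creal tR).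
  by rewrite ReE; field.
rewrite ltrBlDr ltrDl mulr_gt0 ?mulr_gt0 // subr_gt0.
apply: (@lt_trans _ _ ('Re c)); last by rewrite mulr_natl mulr2n ltrDl.
apply: le_lt_trans re; rewrite -mulrA ler_pM2l //.
rewrite /e ler_wpDl ?(ltW c0) // ler_wpM2r ?exprn_ge0 //; exact: w_le.
Qed.

(** By [reflectionE], the reflection at z is a monomial of modulus at most 1 times the conjugate of
    [p] at 1 / conj z. Both z and that point lie near [zeta], so [vanishing_bound] for [p] serves
    twice. *)
Lemma inward_vanishing_bound (n : multinom d) (M : nat) (p : mpoly d K) :
  multidegree_le n p -> vanishes_at_least_to_order zeta M p ->
  exists B delta : K, [/\ 0 < delta <= 1, 0 < B & forall r, 0 < r < delta ->
    `|(line_poly zeta y p).[r]| <= B * r ^+ M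
    /\ `|(line_poly zeta y (reflection n p)).[r]| <= B * r ^+ M].
Proof.
move=> pn /vanishing_bound[B B0 pB].
have W0 : 0 < W%:R :> K by rewrite ltr0n.
(* For r < 1/(2W) every 1 - r (w i + 1) is at least 1/2, so z and its reflected point are within 2 W
   r <= 1 of [zeta] in each coordinate. *)
exists (B * (W%:R *+ 2) ^+ M), ((W%:R *+ 2)^-1); split.
- rewrite invr_gt0 pmulrn_lgt0 // W0 invf_le1 ?pmulrn_lgt0 //.
  by rewrite -mulrnA -[1]/(1%:R) ler_nat.
- by rewrite mulr_gt0 // exprn_gt0 // pmulrn_lgt0.
move=> r /andP[r0 rW].
have rho1 : W%:R *+ 2 * r <= 1.
  by rewrite -ler_pdivlMl ?pmulrn_lgt0 // mulr1 ltW.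
have rho0 : 0 <= W%:R *+ 2 * r by rewrite mulr_ge0 ?ltW // pmulrn_lgt0.
have rw i : r * (w i).+1%:R <= 2^-1.
  apply: (@le_trans _ _ (r * W%:R)); first by rewrite ler_pM2l.
  by rewrite -[2^-1]mul1r ler_pdivlMr // -mulrA mulrC (mulr_natr _ 2).
have half1 : 2^-1 <= 1 :> K by rewrite invf_le1 // ler1n.
have rwW i : r * (w i).+1%:R <= W%:R *+ 2 * r.
  by rewrite mulrC ler_pM2r // (le_trans (w_le i)) // mulr2n lerDl ltW.
have den i : 2^-1 <= 1 - r * (w i).+1%:R.
  have -> : 2^-1 = 1 - 2^-1 :> K by field.
  by rewrite lerD2l lerN2.
have den0 i : 0 < 1 - r * (w i).+1%:R by apply: lt_le_trans (den i); rewrite invr_gt0.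
have zeta1 i : `|zeta 0 i| = 1 by apply: zetaT.
rewrite -mulrA -exprMn !horner_line_poly; split.
  apply: pB => [|i]; first by rewrite rho0.
  by rewrite !mxE mulrCA normrM normrN zeta1 mul1r ger0_norm ?mulr_ge0 // ltW.
rewrite reflectionE // => [|i]; last first.
  by rewrite inwardE mulf_neq0 // -?(normr_eq0 (zeta 0 i)) ?zeta1 ?oner_eq0 // gt_eqF.
rewrite normrM norm_conjC.
apply: (@le_trans _ _ (1 * (B * (W%:R *+ 2 * r) ^+ M))); last by rewrite mul1r.
apply: ler_pM => //.
  rewrite normr_prod prodr_ile1 // => i _; rewrite normr_ge0 /= normrX.
  rewrite exprn_ile1 // inwardE normrM zeta1 mul1r gtr0_norm //.
  by rewrite gerBl mulr_ge0 // ltW.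
(* The reflected point 1 / conj z = zeta + x is also at distance O(r) from zeta. *)
pose x : 'rV[K]_d := \row_i (zeta 0 i * (r * (w i).+1%:R / (1 - r * (w i).+1%:R))).
have -> : meval (fun i => (((zeta + r *: y) 0 i)^*)^-1) p = meval ((zeta + x) 0) p.
  apply: meval_eq => i; rewrite inwardE !mxE rmorphM /=.
  have -> : (1 - r * (w i).+1%:R)^* = 1 - r * (w i).+1%:R.
    by apply/CrealP; rewrite gtr0_real.
  have -> : (zeta 0 i)^* = (zeta 0 i)^-1 by rewrite invC_norm zeta1 expr1n invr1 mul1r.
  by rewrite invfM invrK; field; have := den0 i; rewrite -nat1r => /gt_eqF ->.
apply: pB => [|i]; first by rewrite rho0.
rewrite mxE normrM zeta1 mul1r ger0_norm; last first.
  by rewrite divr_ge0 ?mulr_ge0 ?ltW.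
rewrite ler_pdivrMr //.
apply: (@le_trans _ _ (W%:R *+ 2 * r * 2^-1)); last first.
  by rewrite ler_wpM2l.
rewrite -[W%:R *+ 2]mulr_natr mulrAC mulfK ?pnatr_eq0 // mulrC ler_pM2r //.
Qed.

End Inward.

(** * Order of vanishing of the perturbation *)

(** Multiply by |b|^2. As division by 0 yields 0, a positive real part also certifies that b is
    nonzero. *)
Lemma Re_div_gt0 (K : numClosedFieldType) (a b : K) :
  0 < 'Re (a / b) -> 0 < 'Re (a * b^*) /\ b != 0.
Proof.
have [->|b0] := eqVneq b 0; first by rewrite invr0 mulr0 raddf0 ltxx.
have bb : 0 < `|b| ^- 2 by rewrite invr_gt0 exprn_gt0 // normr_gt0.
by rewrite invC_norm (mulrCA a) (ReMl (gtr0_real bb)) pmulr_rgt0.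
Qed.

Lemma vanishing_order_perturbation (K : numClosedFieldType) (d : nat)
    (n : multinom d) (p v : mpoly d K) (eps : K) (zeta : 'rV[K]_d) (M : nat) :
  multidegree_le n p -> 0 < eps -> polytorus K d zeta ->
  vanishes_at_least_to_order zeta M p ->
  (forall (t : K) z, t = 1 \/ t = - eps -> polydisk K d z ->
     0 < 'Re (meval (z 0) (p + reflection n p + t * 2%:R *: v)
              / meval (z 0) (p - reflection n p))) ->
  vanishes_at_least_to_order zeta M v.
Proof.
move=> pn eps0 zetaT pM pos k kM.
(* Strong induction: the terms of [v] below degree N already vanish, so 'X^N divides its restriction
   to any line through [zeta]. *)
elim/ltn_ind: k kM => N IHN NM.
apply: (@mpoly_eq0_infinite_grid K d (fun i l => - zeta 0 i * l.+1%:R)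
          (homogeneous_term zeta N v)).
  move=> i a b /mulfI ab; apply/eqP; rewrite -eqSS -(eqr_nat K) ab ?oppr_eq0 //.
  by rewrite -normr_eq0 zetaT oner_eq0.
move=> w; have [B [delta [dP B0 pB]]] := inward_vanishing_bound w zetaT pn pM.
set y := inward zeta w.
have -> : meval (fun i => - zeta 0 i * (w i).+1%:R) (homogeneous_term zeta N v)
          = meval (y 0) (homogeneous_term zeta N v).
  by apply: meval_eq => i; rewrite mxE.
have [P PE] : exists Q, line_poly zeta y p = Q * 'X^M.
  by apply: (bigO_polyXn_dvd dP B0) => r /pB[].
have [Pt PtE] : exists Q, line_poly zeta y (reflection n p) = Q * 'X^M.
  by apply: (bigO_polyXn_dvd dP B0) => r /pB[].
set a := meval _ _.
pose V := drop_poly N (line_poly zeta y v).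
have VE : line_poly zeta y v = V * 'X^N.
  rewrite -[LHS](poly_take_drop N); rewrite [take_poly _ _](_ : _ = 0) ?add0r //.
  apply/polyP => k; rewrite coef_take_poly coef0; case: ltnP => // kN.
  by rewrite coef_line_poly IHN ?meval0 // (ltn_trans kN).
have V0 : V.[0] = a by rewrite horner_coef0 coef_drop_poly coef_line_poly.
(* The numerator of f + t u on the line, divided by 'X^N. Since N < M, only the contribution of [v]
   remains at 0. *)
pose A t := (P + Pt) * 'X^(M - N) + (t * 2) *: V.
have A0 t : (A t).[0] = t * 2 * a.
  by rewrite !hornerE V0 expr0n subn_eq0 leqNgt NM /= mulr0 add0r.
have AE t s : (A t * 'X^N).[s]
    = meval ((zeta + s *: y) 0) (p + reflection n p + t * 2%:R *: v).
  rewrite !mevalD mevalZ -!horner_line_poly PE PtE VE /A -(subnK (ltnW NM)).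
  by rewrite addnK exprD !hornerE !mulrDl.
have posA t (c : K) : t = 1 \/ t = - eps -> 0 < 'Re c ->
    exists2 delta : K, 0 < delta <= 1 & forall r, 0 < r < delta ->
    0 < 'Re ((A t * 'X^N).[r * c] * (((P - Pt) * 'X^M).[r * c])^*)
    /\ ((P - Pt) * 'X^M).[r * c] != 0.
  move=> tP c0; have [delta' dP' disk] := inward_polydisk w zetaT c0.
  exists delta' => // r /disk /(pos _ _ tP) /Re_div_gt0.
  by rewrite -AE mevalB -!horner_line_poly PE PtE -hornerN -hornerD -mulrBl.
have D0 : P - Pt != 0.
  have [|delta' /andP[d'0 d'1] /(_ (delta' / 2))[]] :=
    posA 1 1 (or_introl erefl) _; first by rewrite (Creal_ReP _ _) ?real1 ?ltr01.
    by rewrite divr_gt0 //= ltr_pdivrMr // ltr_pMr // ltr1n.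
  by move=> _; apply: contraNneq => ->; rewrite mul0r horner0.
(* Extra zeros from cancellation in p - p~ are split off, so that D(0) is nonzero; the denominator
   then has order j + M > N at 0. *)
have [j [D]] := multiplicity_XsubC (P - Pt) 0; rewrite D0 /= subr0 => D_root DE.
have lead t c : t = 1 \/ t = - eps -> 0 < 'Re c ->
    0 <= 'Re (t * 2 * a * c ^+ N * (D.[0] * c ^+ (j + M))^*).
  move=> tP c0; have [delta' dP' h] := posA t c tP c0.
  rewrite -A0; apply: (ray_leading_ge0 dP') => r /h[].
  by rewrite exprD mulrA -DE.
(* The values t = 1 and t = -eps give opposite inequalities for the same leading term, whose real
   part is therefore 0 throughout the half-plane. *)
have : a * (D.[0])^* = 0.
  apply: (@half_plane_re_eq0 _ _ N (j + M)); first exact: ltn_addl.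
  move=> c c0; apply/eqP; rewrite eq_le.
  have := lead _ c (or_intror erefl) c0; have := lead _ c (or_introl erefl) c0.
  set z := _ * (_ * _).
  have -> : 1 * 2 * a * c ^+ N * (D.[0] * c ^+ (j + M))^* = 2 * z.
    by rewrite /z rmorphM /=; ring.
  have -> : - eps * 2 * a * c ^+ N * (D.[0] * c ^+ (j + M))^* = - (eps * 2) * z.
    by rewrite /z rmorphM /=; ring.
  have eps2 : - (eps * 2) < 0 by rewrite oppr_lt0 mulr_gt0.
  rewrite (ReMl (realn _ 2)) (ReMl (ltr0_real eps2)) pmulr_rge0 // nmulr_rge0 //.
  by move=> -> ->.
by move/eqP; rewrite mulf_eq0 conjC_eq0 -rootE (negPf D_root) orbF => /eqP.
Qed.

(** * Faces and the conclusion *)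

Lemma face_extension (K : numFieldType) (V : lmodType K) (S : set V) (x y : V) :
  face S x y -> S y /\ exists2 e : K, 0 < e & S (x - e *: (y - x)).
Proof.
move=> [[a [b [_ sub [t /andP[t0 t1] xE] [s /andP[s0 s1] yE]]]]|[[Sx _] ->]].
  have segE (u : K) : (1 - u) *: a + u *: b = a + u *: (b - a).
    by rewrite scalerBl scale1r scalerBr addrAC -addrA.
  split; first by apply: sub; exists s; rewrite ?s0.
  have u0 : 0 < 1 - t by rewrite subr_gt0.
  (* On the segment the new point has parameter t - e (s - t). As |s - t| <= 1 and t (1 - t) is at
     most both t and 1 - t, it stays in [0, 1]. *)
  exists (t * (1 - t)); first by rewrite mulr_gt0.
  apply: sub; exists (t - t * (1 - t) * (s - t)); last first.
    rewrite xE yE !segE opprD addrACA subrr add0r -scalerBl scalerA.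
    by rewrite [in RHS]scalerBl addrA.
  apply/andP; split.
    have -> : t - t * (1 - t) * (s - t) = t * ((1 - t) * (1 - s + t) + t) by ring.
    by rewrite mulr_ge0 ?ltW // ltr_wpDl // mulr_ge0 ?ltW // ltr_wpDl // subr_ge0.
  rewrite -subr_ge0.
  have -> : 1 - (t - t * (1 - t) * (s - t)) = (1 - t) * (t * s + (1 - t) * (1 + t)).
    by ring.
  by rewrite mulr_ge0 ?ltW // ltr_wpDl ?mulr_ge0 ?(ltW t0) // mulr_gt0 // addr_gt0.
(* At an extreme point y = x, so any step size works. *)
by split => //; exists 1; rewrite // subrr scaler0 subr0.
Qed.

(** Passes from [complex.Re], valued in [R], to 'Re, valued in [R[i]]. *)
Lemma PRP_Re_gt0 (R : realType) (d : nat) (f : 'rV[R[i]]_d -> R[i]) z :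
  PRP R d f -> polydisk R[i] d z -> 0 < 'Re (f z).
Proof.
move=> [_ _ f_pos _] /f_pos.
by rewrite ReE -[(_ + _) / _]ReJ_add (ltcR 0).
Qed.

Theorem theorem1p3 (R : realType) (d : nat) (d_ge1 : (1 <= d)%N)
    (n : multinom d) (p : mpoly d R[i])
    (p_deg : multidegree_le n p)
    (p_zero_free : zero_free p)
    (p_coprime : no_common_factor p (reflection n p))
    (pt0 : meval (fun=> 0) (reflection n p) = 0)
    (v : mpoly d R[i])
    (v_deg : multidegree_le n v)
    (v_refl : v = reflection n v)
    (v0 : meval (fun=> 0) v = 0)
    (v_zero_free : exists2 a : R, 0 < a &
       zero_free (p + v) /\ zero_free (p - a%:C *: v))
    (v_face :
       face (PRP R d)
         (ratfun (p + reflection n p) (p - reflection n p))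
         (ratfun (p + reflection n p + 2%:R *: v) (p - reflection n p)))
    (zeta : 'rV[R[i]]_d) (zetaT : polytorus R[i] d zeta)
    (M : nat) (p_order : vanishes_to_order zeta M p) :
  vanishes_at_least_to_order zeta M v.
Proof.
have [f1 [eps eps0 feps]] := face_extension v_face.
apply: (vanishing_order_perturbation p_deg eps0 zetaT (proj1 p_order)).
have ratE (a b : mpoly d R[i]) z : polydisk R[i] d z ->
    ratfun a b z = meval (z 0) a / meval (z 0) b.
  by move=> zD; rewrite /ratfun /on_polydisk patchT ?inE.
(* t = 1 is the given element of the face; t = -eps is the point reached by extending the segment
   beyond f. *)
move=> t z [] -> zD.
  by rewrite mul1r -ratE //; exact: PRP_Re_gt0 f1 zD.
have := PRP_Re_gt0 feps zD; congr (0 < 'Re _).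
transitivity (ratfun (p + reflection n p) (p - reflection n p) z
  - eps * (ratfun (p + reflection n p + 2%:R *: v) (p - reflection n p) z
           - ratfun (p + reflection n p) (p - reflection n p) z)) => //.
rewrite !ratE // -mulrBl mulrA -mulrBl; congr (_ / _).
by rewrite !mevalD !mevalZ; ring.
Qed.
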